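(* Let $A$ and $B$ be vector spaces over a field of characteristic $0$, let $\mu:A\times A\to A$, $\nu:B\times B\to B$, $\vartriangleright:A\times B\to B$, $\vartriangleleft:B\times A\to B$, $\rightharpoonup:B\times A\to A$, $\leftharpoonup:A\times B\to A$, $\theta:A\times A\to B$ be bilinear maps and $r:B\to A$ a linear map. Write $a\cdot_A b=\mu(a,b)$, $x\cdot_B y=\nu(x,y)$, and let $\Omega\in\mathscr Q_1$ be $$\Omega((a,x),(b,y))=(a\cdot_A b+a\leftharpoonup y+x\rightharpoonup b,\ x\cdot_B y+a\vartriangleright y+x\vartriangleleft b+\theta(a,b)).$$ Then the tuple $(A_\mu,B_\nu,\vartriangleright,\vartriangleleft,\rightharpoonup,\leftharpoonup,\theta)$ is a quasi-twilled associative algebra and $r:B\to A$ is a weak deformation map in it if and only if the element $\alpha=(\Omega[1],r)\in(\mathscr Q[1]\oplus\mathfrak b)_0$ is a Maurer-Cartan element of the $L_\infty$-algebra $(\mathscr Q[1]\oplus\mathfrak b,\{\widetilde l_k\}_{k=1}^\infty)$ described in the context.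
   Context: The tuple $(A_\mu,B_\nu,\vartriangleright,\vartriangleleft,\rightharpoonup,\leftharpoonup,\theta)$ is a quasi-twilled associative algebra if the multiplication $\Omega$ on $A\oplus B$ is associative (i.e. $A\oplus B$ is an associative algebra having $B$ as a subalgebra, with these components). A weak deformation map in it is a linear map $r:B\to A$ with $r(x)\cdot_A r(y)+r(x)\leftharpoonup y+x\rightharpoonup r(y)=r\big(x\cdot_B y+r(x)\vartriangleright y+x\vartriangleleft r(y)+\theta(r(x),r(y))\big)$ for all $x,y\in B$. Let $\mathfrak g=\bigoplus_{n\ge0}\mathfrak g_n$, $\mathfrak g_n=\mathrm{Hom}((A\oplus B)^{\otimes n+1},A\oplus B)$, with the Gerstenhaber bracket: for $f$ with $m$ inputs and $g$ with $n$ inputs, $[f,g]=f\diamond g-(-1)^{(m-1)(n-1)}g\diamond f$, where $(f\diamond g)(v_1,\ldots,v_{m+n-1})=\sum_{i=1}^m(-1)^{(i-1)(n-1)}f(v_1,\ldots,v_{i-1},g(v_i,\ldots,v_{i+n-1}),v_{i+n},\ldots,v_{m+n-1})$. Let $\mathfrak b=\bigoplus_{n\ge0}\mathfrak b_n$, $\mathfrak b_n=\mathrm{Hom}(B^{\otimes n+1},A)\subset\mathfrak g_n$ (extension by zero), and $P:\mathfrak g\to\mathfrak b$ the projection: $P(F)$ is the $A$-component of $F|_{B^{\otimes n+1}}$ for $F\in\mathfrak g_n$. Let $\mathcal A^{k,l}$ be the direct sum of all $(k+l)$-fold tensor products with $k$ factors $A$ and $l$ factors $B$. For $k,l\ge-1$,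 $k+l=n$, $C^{k|l}\subset\mathfrak g_n$ is the space of $f$ with $f(\mathcal A^{k+1,l})\subset A$, $f(\mathcal A^{k,l+1})\subset B$, $f=0$ on other components. Put $\mathscr Q_n=C^{n+1|-1}\oplus C^{n|0}\oplus\cdots\oplus C^{0|n}$; $\mathscr Q=\bigoplus_{n\ge0}\mathscr Q_n$ is a graded Lie subalgebra of $\mathfrak g$. Write $(\mathscr Q[1])_n=\mathscr Q_{n+1}$, $F[1]$ for $F\in\mathscr Q$ viewed in $\mathscr Q[1]$. The $L_\infty$-structure on $\mathscr Q[1]\oplus\mathfrak b$ (degree $1$ graded symmetric operations satisfying the $L_\infty$ identities) has operations $\widetilde l_2(F[1],G[1])=(-1)^{|F|}[F,G][1]$ ($|F|$ the degree of $F$ in $\mathscr Q$) and $\widetilde l_k(F[1],f_1,\ldots,f_{k-1})=P[\cdots[[F,f_1],f_2],\ldots,f_{k-1}]$ for $k\ge2$, with $F,G\in\mathscr Q$, $f_i\in\mathfrak b$ homogeneous; up to permutation of entries all other components vanish. A Maurer-Cartan element is a degree $0$ element $\alpha$ with $\sum_{k\ge1}\frac1{k!}\widetilde l_k(\alpha,\ldots,\alpha)=0$ (a finite sum here). *)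

(* Defs.v *)
From HB Require Import structures.
From mathcomp Require Import all_boot all_order all_algebra.

Set Implicit Arguments.
Unset Strict Implicit.
Unset Printing Implicit Defensive.

Import GRing.Theory.
Local Open Scope ring_scope.

Section Cochains.
Variables (K : fieldType) (A B : lmodType K).

Notation V := (A * B)%type.

(* Since tensor powers of arbitrary vector spaces are not available, a linear
   map V^{\otimes m} -> V is a multilinear function of the sequence of its
   m arguments, extended by 0 to sequences of any other length. *)
Definition cochain := seq V -> V.

Definition multilinear (m : nat) (f : cochain) : Prop :=
  (forall s, size s <> m -> f s = 0) /\
  (forall s1 s2 (c : K) (u v : V),
     f (s1 ++ (c *: u + v) :: s2) =
     c *: f (s1 ++ u :: s2) + f (s1 ++ v :: s2)).

(* The degrees are integers because (Q[1])_{-1} = Q_0 is not zero. *)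
Definition gspace (d : int) (f : cochain) : Prop :=
  match d with
  | Posz n => multilinear n.+1 f
  | Negz _ => forall s, f s = 0
  end.

Definition arity (d : int) : nat := absz (d + 1).

(* [circ p q f g] is f \diamond g for f of degree p and g of degree q; the
   index i of the sum is the number of arguments of f preceding g. *)
Definition circ (p q : int) (f g : cochain) : cochain := fun s =>
  \sum_(i < arity p)
    ((-1) ^ (i%:Z * q) : K) *:
      f (take i s ++ g (take (arity q) (drop i s)) :: drop (i + arity q) s).

Definition gbracket (p q : int) (f g : cochain) : cochain := fun s =>
  circ p q f g s - ((-1) ^ (p * q) : K) *: circ q p g f s.

(* [[...[[F, f_1], f_2], ...], f_m], each map being paired with its degree *)
Fixpoint nested_bracket (p : int) (F : cochain) (fs : seq (int * cochain)) :
    cochain :=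
  match fs with
  | [::] => F
  | (q, f) :: fs' => nested_bracket (p + q) (gbracket p q F f) fs'
  end.

(* Sequences over A + B stand for the pure tensors of the spaces A^{k,l}. *)
Definition incl (t : A + B) : V :=
  match t with inl a => (a, 0) | inr x => (0, x) end.

Definition nA (t : seq (A + B)) : nat := count is_inl t.
Definition nB (t : seq (A + B)) : nat := count (predC is_inl) t.

Definition bspace (d : int) (f : cochain) : Prop :=
  gspace d f /\
  forall t : seq (A + B),
    (nA t = 0%N -> (f (map incl t)).2 = 0) /\
    (nA t <> 0%N -> f (map incl t) = 0).

Definition proj (F : cochain) : cochain := fun s =>
  ((F [seq (0, v.2) | v <- s]).1, 0).

Definition Cspace (k l : int) (f : cochain) : Prop :=
  gspace (k + l) f /\
  forall t : seq (A + B),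
    let a := (nA t)%:Z in
    let b := (nB t)%:Z in
    (a = k + 1 -> b = l -> (f (map incl t)).2 = 0) /\
    (a = k -> b = l + 1 -> (f (map incl t)).1 = 0) /\
    (~ (a = k + 1 /\ b = l) -> ~ (a = k /\ b = l + 1) ->
       f (map incl t) = 0).

Definition Qspace (d : int) (F : cochain) : Prop :=
  match d with
  | Posz n => exists c : 'I_n.+2 -> cochain,
      (forall k : 'I_n.+2, Cspace k%:Z (n%:Z - k%:Z) (c k)) /\
      (forall s, F s = \sum_(k < n.+2) c k s)
  | Negz _ => forall s, F s = 0
  end.

(* A homogeneous element (F[1], f) of Q[1] (+) b together with its degree *)
Record elt := Elt { edeg : int; Qpart : cochain; bpart : cochain }.

Definition is_elt (x : elt) : Prop :=
  Qspace (edeg x + 1) (Qpart x) /\ bspace (edeg x) (bpart x).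

(* The components in Q[1] and in b of l_k(x_0, ..., x_{k-1}): a k-tuple of
   arguments is given by a function on nat, only used below k.  The value on
   arbitrary homogeneous arguments is obtained by expanding each argument as
   F[1] + f.  In b there is one term for every choice of the position i of the
   single entry from Q[1]; moving it to the front past x_0, ..., x_{i-1}
   produces the Koszul sign. *)
Definition lQ (k : nat) (x : nat -> elt) : cochain := fun s =>
  if k == 2 then
    let p := edeg (x 0) + 1 in
    let q := edeg (x 1) + 1 in
    ((-1) ^ p : K) *: gbracket p q (Qpart (x 0)) (Qpart (x 1)) s
  else 0.

Definition lb (k : nat) (x : nat -> elt) : cochain := fun s =>
  if (2 <= k)%N then
    \sum_(i < k)
      ((-1) ^ (edeg (x i) * \sum_(j < i) edeg (x j)) : K) *:
        proj (nested_bracket (edeg (x i) + 1) (Qpart (x i))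
                [seq (edeg (x j), bpart (x j)) | j <- iota 0 k & j != i :> nat]) s
  else 0.

(* The sum over k >= 1 is required to have finitely many nonzero terms. *)
Definition maurer_cartan (x : elt) : Prop :=
  [/\ is_elt x, edeg x = 0 &
   exists N : nat,
     (forall k s, (N < k)%N ->
        lQ k (fun=> x) s = 0 /\ lb k (fun=> x) s = 0) /\
     (forall s,
        \sum_(1 <= k < N.+1) ((k`!)%:R^-1 : K) *: lQ k (fun=> x) s = 0 /\
        \sum_(1 <= k < N.+1) ((k`!)%:R^-1 : K) *: lb k (fun=> x) s = 0)].

Definition cochain1 (r : B -> A) : cochain := fun s =>
  if s is [:: v] then (r v.2, 0) else 0.

Definition cochain2 (m : V -> V -> V) : cochain := fun s =>
  if s is [:: u; v] then m u v else 0.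

End Cochains.

Section QuasiTwilled.
Variables (K : fieldType) (A B : lmodType K).
Variables (mu : A -> A -> A) (nu : B -> B -> B).
(* tr a x, tl x a, hl x a and hr a x are a \vartriangleright x,
   x \vartriangleleft a, x \rightharpoonup a and a \leftharpoonup x. *)
Variables (tr : A -> B -> B) (tl : B -> A -> B).
Variables (hl : B -> A -> A) (hr : A -> B -> A) (theta : A -> A -> B).

Definition Omega (u v : A * B) : A * B :=
  (mu u.1 v.1 + hr u.1 v.2 + hl u.2 v.1,
   nu u.2 v.2 + tr u.1 v.2 + tl u.2 v.1 + theta u.1 v.1).

Definition quasi_twilled : Prop := associative Omega.

Definition weak_deformation_map (r : B -> A) : Prop :=
  forall x y : B,
    mu (r x) (r y) + hr (r x) y + hl x (r y) =
    r (nu x y + tr (r x) y + tl x (r y) + theta (r x) (r y)).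

Definition alpha (r : B -> A) : elt A B :=
  Elt 0 (cochain2 Omega) (cochain1 r).

End QuasiTwilled.

(* Main.v *)
Require Import Defs.
From mathcomp Require Import all_boot all_order all_algebra.

(** Let R be the endomorphism (a, x) |-> (r x, 0) of A + B ([rext]); R composed
    with R is 0.

    The two components of the Maurer-Cartan equation separate the two
    properties.  In the component Q[1] only the operation with two arguments
    contributes, and it gives minus one half of the bracket of Omega with itself,
    that is, the associator of Omega up to sign ([sum_lQ_alpha]).  Its vanishing
    is the quasi-twilled condition.

    In the component b, each of the k positions for the entry Omega[1] gives
    the same term, so that l_k / k! contributes the k-1 fold bracket of Omega
    with r, divided by (k-1)! ([scaled_lb_alpha]).  On binary maps, the bracket
    with r is the operator
      M |-> M (R u) v + M u (R v) - R (M u v)     ([twist], [gbracket_cochain1])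
    and, because R composed with R is 0, its iterates on Omega are explicit and
    vanish from the fourth on ([iter_twistE]).  On arguments of B, the terms of
    order 1, 2 and 3 have the A-components
      hr (r x) y + hl x (r y) - r (nu x y),
      2 (mu (r x) (r y) - r (tr (r x) y + tl x (r y))),
      - 6 r (theta (r x) (r y)),
    and dividing them by 1!, 2! and 3! and adding up gives the difference of the
    two sides of the equation of a weak deformation map ([sum_lb_alpha]). *)

Set Implicit Arguments.
Unset Strict Implicit.
Unset Printing Implicit Defensive.

Import GRing.Theory.
Local Open Scope ring_scope.

(** * Sums and linear combinations *)

Lemma eq_sum_vanishing (V : zmodType) (F : nat -> V) (N M : nat) :
  (forall k, (N < k)%N -> F k = 0) -> (forall k, (M < k)%N -> F k = 0) ->
  \sum_(1 <= k < N.+1) F k = \sum_(1 <= k < M.+1) F k.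
Proof.
wlog leNM : N M / (N <= M)%N.
  move=> H FN FM; case/orP: (leq_total N M) => /H E; first exact: E.
  by apply/esym/E.
move=> FN _; rewrite (@big_cat_nat _ _ _ N.+1 1 M.+1) //=.
rewrite [X in _ + X]big_nat_cond [X in _ + X]big1 ?addr0 // => k.
by rewrite andbT => /andP[/FN].
Qed.

Lemma scale_addACA (K : pzRingType) (V : lmodType K) (c : K) (p q p' q' : V) :
  (c *: p + q) + (c *: p' + q') = c *: (p + p') + (q + q').
Proof. by rewrite scalerDr addrACA. Qed.

Lemma natr_neq0_char0 (K : fieldType) (n : nat) :
  [pchar K] =i pred0 -> n.+1%:R != 0 :> K.
Proof. by move=> /(iffLR (pcharf0P K)) ->. Qed.

(** * The bracket of a binary map with [r] *)

Section Twist.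
Variables (K : fieldType) (A B : lmodType K) (r : {linear B -> A}).
Implicit Types (M : A * B -> A * B -> A * B) (u v : A * B).

(** The extension by zero of [r] to an endomorphism of A + B: the map whose
    cochain is [cochain1 r]. *)
Definition rext (v : A * B) : A * B := (r v.2, 0).

(** The bracket of a binary map with [r], again as a binary map. *)
Definition twist M u v : A * B :=
  M (rext u) v + M u (rext v) - rext (M u v).

Lemma rextD : {morph rext : u v / u + v}.
Proof. by move=> u v; rewrite /rext linearD; congr pair; rewrite addr0. Qed.

Lemma rextN : {morph rext : v / - v}.
Proof. by move=> v; rewrite /rext linearN; congr pair; rewrite /= oppr0. Qed.

Lemma rext_rext v : rext (rext v) = 0.
Proof. by rewrite /rext linear0. Qed.

Lemma rext0 : rext 0 = 0.
Proof. exact: (rext_rext 0). Qed.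

Lemma twist0r M : (forall u, M u 0 = 0) -> forall u, twist M u 0 = 0.
Proof. by move=> M0 u; rewrite /twist rext0 !M0 rext0 !addr0 subrr. Qed.

Lemma twist0l M : (forall v, M 0 v = 0) -> forall v, twist M 0 v = 0.
Proof. by move=> M0 v; rewrite /twist rext0 !M0 rext0 !addr0 subrr. Qed.

(** Cochains are functions and are only compared pointwise; iterating a bracket
    up to pointwise equality requires this congruence and the next one. *)
Lemma eq_gbracket p q (f f' g : cochain A B) :
  (forall s, f s = f' s) -> forall s, gbracket p q f g s = gbracket p q f' g s.
Proof.
move=> ff' s; rewrite /gbracket /circ; congr (_ - _ *: _).
  by apply: eq_bigr => i _; rewrite ff'.
by apply: eq_bigr => i _; rewrite ff'.
Qed.

Lemma eq_nested_bracket (fs : seq (int * cochain A B)) p (f f' : cochain A B) :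
  (forall s, f s = f' s) ->
  forall s, nested_bracket p f fs s = nested_bracket p f' fs s.
Proof.
elim: fs p f f' => [//|[q g] fs IH] p f f' ff' s /=.
by apply: IH; apply: eq_gbracket.
Qed.

(** The two conditions on M, weaker than bilinearity, make the bracket vanish
    on sequences of length other than 2. *)
Lemma gbracket_cochain1 M : (forall u, M u 0 = 0) -> (forall v, M 0 v = 0) ->
  forall s, gbracket 1 0 (cochain2 M) (cochain1 r) s = cochain2 (twist M) s.
Proof.
move=> Mr Ml s; rewrite /gbracket /circ /arity /=.
rewrite mulr0 expr0z scale1r (big_ord_recl 1) !big_ord1 /=.
rewrite !mulr0 !expr0z !scale1r.
case: s => [|u [|v [|w s]]] /=.
- by rewrite linear0 !addr0 subrr.
- by rewrite Mr linear0 !addr0 subrr.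
- done.
- by rewrite linear0 !addr0.
Qed.

Lemma nested_bracket_cochain1 m M :
  (forall u, M u 0 = 0) -> (forall v, M 0 v = 0) ->
  forall s, nested_bracket 1 (cochain2 M) (nseq m (0, cochain1 r)) s =
            cochain2 (iter m twist M) s.
Proof.
elim: m M => [//|m IH] M Mr Ml s; rewrite iterSr /=.
rewrite -IH; first 1 last.
- exact: twist0r.
- exact: twist0l.
exact/eq_nested_bracket/gbracket_cochain1.
Qed.

(** The bracket of a binary map with itself is twice its associator. *)
Lemma gbracket_cochain2 M : (forall u, M u 0 = 0) -> (forall v, M 0 v = 0) ->
  forall s, gbracket 1 1 (cochain2 M) (cochain2 M) s =
    if s is [:: u; v; w] then (M (M u v) w - M u (M v w)) *+ 2 else 0.
Proof.
move=> Mr Ml s; rewrite /gbracket /circ /arity /=.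
rewrite (big_ord_recl 1) !big_ord1 /= mul0r mul1r expr0z expr1z.
rewrite scale1r !scaleN1r opprK.
by case: s => [|u [|v [|w [|z s]]]] /=;
  rewrite ?take0 ?drop0 ?Mr ?Ml ?subr0 ?addr0.
Qed.

Local Notation R := rext.

(** Every application of [twist] inserts R once, in an argument or, with a
    minus sign, in the value.  As R composed with R is 0, each of these three
    places takes R at most once: there are 2 orders in which two of them can be
    filled, 6 in which all three can, and nothing is left afterwards. *)
Lemma iter_twistE M : (forall u, M u 0 = 0) -> (forall v, M 0 v = 0) ->
  [/\ forall u v, iter 2 twist M u v =
        (M (R u) (R v) - R (M (R u) v + M u (R v))) *+ 2,
      forall u v, iter 3 twist M u v = - R (M (R u) (R v)) *+ 6 &
      forall m u v, iter m.+4 twist M u v = 0].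
Proof.
move=> Mr Ml.
have E2 u v : iter 2 twist M u v =
    (M (R u) (R v) - R (M (R u) v + M u (R v))) *+ 2.
  rewrite /= /twist !rext_rext Mr Ml !rextD !rextN !rext_rext.
  rewrite add0r addr0 oppr0 addr0 !mulr2n.
  by rewrite [X in X - _ = _]addrACA -opprD -[LHS]addrA [RHS]addrACA.
have RMn x n : R (x *+ n) = R x *+ n.
  elim: n => [|n IH]; first by rewrite !mulr0n rext0.
  by rewrite !mulrS rextD IH.
have E3 u v : iter 3 twist M u v = - R (M (R u) (R v)) *+ 6.
  rewrite iterS {1}/twist !E2 !rext_rext !Mr !Ml !RMn.
  rewrite !rextD !rextN !rextD !rext_rext.
  by rewrite rext0 !(sub0r, addr0, add0r, subr0) -mulNrn -!mulrnDr.
split=> // m; elim: m => [|m IH] u v.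
  rewrite iterS {1}/twist !E3 !rext_rext !Mr !Ml RMn rextN rext_rext.
  by rewrite oppr0 rext0 oppr0 !mul0rn subr0 addr0.
by rewrite iterS /twist !IH rext0 addr0 subrr.
Qed.
End Twist.

(** * Binary maps as cochains *)

Section Cochain2.
Variables (K : fieldType) (A B : lmodType K).
Implicit Types m : A * B -> A * B -> A * B.

Lemma multilinear_cochain2 m :
  (forall c u u' v, m (c *: u + u') v = c *: m u v + m u' v) ->
  (forall c u v v', m u (c *: v + v') = c *: m u v + m u v') ->
  multilinear 2 (cochain2 m).
Proof.
move=> ml mr; split=> [[|u [|v [|w s]]] //|].
(* Sequences of length other than 2, where both sides are 0. *)
have Z (c : K) : 0 = c *: 0 + 0 :> A * B by rewrite scaler0 addr0.
case=> [|u [|u' s1]] [|v [|v' s2]] c w w' //=; try exact: Z.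
all: by case: s1 => [|? s1]; exact: Z.
Qed.
End Cochain2.

(** * The Maurer-Cartan equation of [alpha] *)

Section Algebra.
Variables (K : fieldType) (A B : lmodType K).
Variables (mu : {bilinear A -> A -> A}) (nu : {bilinear B -> B -> B}).
Variables (tr : {bilinear A -> B -> B}) (tl : {bilinear B -> A -> B}).
Variables (hl : {bilinear B -> A -> A}) (hr : {bilinear A -> B -> A}).
Variables (theta : {bilinear A -> A -> B}) (r : {linear B -> A}).

Local Notation Om := (Omega mu nu tr tl hl hr theta).
Local Notation al := (alpha mu nu tr tl hl hr theta r).

Lemma Omega0r u : Om u 0 = 0.
Proof. by rewrite /Omega /= !linear0r !addr0. Qed.

Lemma Omega0l v : Om 0 v = 0.
Proof. by rewrite /Omega /= !linear0l !addr0. Qed.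

(** The component of Omega in the summand C^{k|1-k} of Q_1, for k = 0, 1, 2. *)
Definition Omega_part (k : nat) (u v : A * B) : A * B :=
  match k with
  | 0 => (hr u.1 v.2 + hl u.2 v.1, nu u.2 v.2)
  | 1 => (mu u.1 v.1, tr u.1 v.2 + tl u.2 v.1)
  | _ => (0, theta u.1 v.1)
  end.

Lemma Omega_part_multilinear k : multilinear 2 (cochain2 (Omega_part k)).
Proof.
by apply: multilinear_cochain2 => c u v w; case: k => [|[|k]];
  rewrite /Omega_part; congr pair;
  rewrite /= ?linearPl ?linearPr ?scale_addACA ?scaler0 ?addr0.
Qed.

Lemma Omega_partC (k : nat) : (k < 3)%N ->
  Cspace k%:Z (1%:Z - k%:Z) (cochain2 (Omega_part k)).
Proof.
move=> k3; split.
  by case: k k3 => [|[|[|]]] // _; exact: Omega_part_multilinear.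
case: k k3 => [|[|[|]]] // _ [|[a|x] [|[b|y] [|w t]]] /=;
  rewrite ?linear0l ?linear0r ?addr0; do ?split => //.
(* The remaining goals claim that the nonzero values vanish, on types of
   arguments assumed to be neither of the two allowed by C^{k|1-k}. *)
all: by move=> H1 H2; first [by case: H1 | by case: H2].
Qed.

Lemma alpha_is_elt : is_elt al.
Proof.
split; last first.
  split; last by case=> [|[a|x] [|y t]] //=; split=> // _; rewrite linear0.
  split=> [[|u [|v s]] //|s1 s2 c u v].
  have Z : 0 = c *: 0 + 0 :> A * B by rewrite scaler0 addr0.
  case: s1 s2 => [|u' s1] [|v' s2] /=; try exact: Z; last 2 first.
  - by case: s1 => *; exact: Z.
  - by case: s1 => *; exact: Z.
  by rewrite linearP; congr pair; rewrite /= scaler0 addr0.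
exists (fun k : 'I_3 => cochain2 (Omega_part k)); split=> [k|s].
  exact: Omega_partC.
rewrite (big_ord_recl 2) (big_ord_recl 1) big_ord1.
case: s => [|u [|v [|w s]]] //=; rewrite ?addr0 //.
rewrite /Omega; congr pair => /=; first by rewrite addr0 [RHS]addrC addrA.
by rewrite !addrA.
Qed.

Lemma lQ_alpha k s : lQ k (fun=> al) s =
  if k == 2 then
    - (if s is [:: u; v; w] then (Om (Om u v) w - Om u (Om v w)) *+ 2 else 0)
  else 0.
Proof.
rewrite /lQ; case: (k == 2) => //=.
rewrite expr1z scaleN1r gbracket_cochain2 //.
- exact: Omega0r.
- exact: Omega0l.
Qed.

(** All entries being equal of degree 0, the k+2 positions of the entry from
    Q[1] give the same term, with sign 1. *)
Lemma lb_alpha k s : lb k.+2 (fun=> al) s =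
  (k.+2)%:R *: proj (cochain2 (iter k.+1 (twist r) Om)) s.
Proof.
rewrite /lb [(2 <= _)%N]/= scaler_nat.
rewrite -[in RHS](card_ord k.+2) -sumr_const; apply: eq_bigr => i _.
rewrite [X in X * _]/= mul0r expr0z scale1r /proj.
set fs := map _ _.
suff -> : fs = nseq k.+1 (0, cochain1 r).
  by rewrite nested_bracket_cochain1 //; [exact: Omega0r|exact: Omega0l].
(* The list of the remaining entries is constant, of length k+1. *)
have -> : k.+1 = size fs.
  rewrite size_map size_filter.
  have := count_predC (pred1 (i : nat)) (iota 0 k.+2).
  rewrite size_iota count_uniq_mem ?iota_uniq // mem_iota ltn_ord /= add1n.
  by case.
by rewrite {}/fs; elim: [seq _ <- _ | _] => //= j t <-.
Qed.

Lemma proj_twist k s :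
  proj (cochain2 (iter k (twist r) Om)) s =
  if s is [:: u; v] then ((iter k (twist r) Om (0, u.2) (0, v.2)).1, 0) else 0.
Proof. by case: s => [|u [|v [|w s]]]. Qed.

Lemma lQ_alpha_gt4 k s : (4 < k)%N -> lQ k (fun=> al) s = 0.
Proof. by rewrite lQ_alpha; case: k => [|[|[|k]]]. Qed.

Lemma lb_alpha_gt4 k s : (4 < k)%N -> lb k (fun=> al) s = 0.
Proof.
case: k => [|[|[|[|[|k]]]]] // _; rewrite lb_alpha proj_twist.
case: s => [|u [|v [|w s]]]; rewrite ?scaler0 //.
have [_ _ ->] := @iter_twistE _ _ _ r _ Omega0r Omega0l.
exact: scaler0.
Qed.

Hypothesis K_char0 : [pchar K] =i pred0.

Lemma scaled_lb_alpha k s : (k.+2`!)%:R^-1 *: lb k.+2 (fun=> al) s =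
  (k.+1`!)%:R^-1 *: proj (cochain2 (iter k.+1 (twist r) Om)) s.
Proof.
rewrite lb_alpha scalerA factS natrM invfM mulrAC mulVf ?natr_neq0_char0 //.
by rewrite mul1r.
Qed.

Lemma sum_lb_alpha s :
  \sum_(1 <= k < 5) (k`!)%:R^-1 *: lb k (fun=> al) s =
  if s is [:: u; v] then
    let x := u.2 in let y := v.2 in
    (mu (r x) (r y) + hr (r x) y + hl x (r y)
     - r (nu x y + tr (r x) y + tl x (r y) + theta (r x) (r y)), 0)
  else 0.
Proof.
rewrite big_nat_recl // big_add1 /= scaler0 add0r.
rewrite 3?big_nat_recl // big_geq // addr0 !scaled_lb_alpha !proj_twist.
case: s => [|u [|v [|w s]]]; rewrite ?scaler0 ?addr0 //.
have [-> -> _] := @iter_twistE _ _ _ r _ Omega0r Omega0l.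
have divn n (w : A * B) :
    (n.+1%:R^-1 : K) *: ((w *+ n.+1).1, 0) = (w.1, 0) :> A * B.
  rewrite (raddfMn (@fst A B)).
  rewrite -scaler_nat; congr pair; rewrite /= ?scaler0 //.
  by rewrite scalerA mulVf ?natr_neq0_char0 // scale1r.
(* The factors 2 and 6 of the iterates are 2! and 3!. *)
rewrite (divn 1) (divn 5) invr1 scale1r.
congr pair; rewrite /= ?addr0 // !(linear0l, linear0r, addr0, add0r).
(* Move the term mu (r x) (r y) to the front. *)
rewrite -!addrA; do 3 rewrite [in LHS](addrCA _ (mu _ _)).
by rewrite !(linearD r, opprD) -!addrA.
Qed.

Lemma sum_lQ_alpha s :
  \sum_(1 <= k < 5) (k`!)%:R^-1 *: lQ k (fun=> al) s =
  if s is [:: u; v; w] then Om u (Om v w) - Om (Om u v) w else 0.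
Proof.
rewrite unlock /= !lQ_alpha /= !scaler0 add0r !addr0.
case: s => [|u [|v [|w [|z s]]]]; rewrite ?oppr0 ?scaler0 //.
rewrite scalerN -scaler_nat scalerA mulVf ?natr_neq0_char0 //.
by rewrite scale1r opprB.
Qed.

(** As all terms beyond the fourth vanish, the sums up to any admissible bound
    N are equal to the sums up to 4. *)
Lemma maurer_cartan_alphaE : maurer_cartan al <->
  forall s, \sum_(1 <= k < 5) (k`!)%:R^-1 *: lQ k (fun=> al) s = 0 /\
            \sum_(1 <= k < 5) (k`!)%:R^-1 *: lb k (fun=> al) s = 0.
Proof.
split=> [[_ _ [N [lN0 lN]]] s|al0]; last first.
  split=> //; first exact: alpha_is_elt.
  by exists 4%N; split=> // k s k4; rewrite lQ_alpha_gt4 ?lb_alpha_gt4.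
have [EQ Eb] := lN s.
split; [apply: etrans EQ | apply: etrans Eb];
  apply: eq_sum_vanishing => k kN.
- by rewrite lQ_alpha_gt4 ?scaler0.
- by have [-> _] := lN0 k s kN; rewrite scaler0.
- by rewrite lb_alpha_gt4 ?scaler0.
- by have [_ ->] := lN0 k s kN; rewrite scaler0.
Qed.

End Algebra.

Theorem theorem7p6 (K : fieldType) (K_char0 : [pchar K] =i pred0)
    (A B : lmodType K)
    (mu : {bilinear A -> A -> A}) (nu : {bilinear B -> B -> B})
    (tr : {bilinear A -> B -> B}) (tl : {bilinear B -> A -> B})
    (hl : {bilinear B -> A -> A}) (hr : {bilinear A -> B -> A})
    (theta : {bilinear A -> A -> B}) (r : {linear B -> A}) :
  (quasi_twilled mu nu tr tl hl hr theta /\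
   weak_deformation_map mu nu tr tl hl hr theta r)
  <-> maurer_cartan (alpha mu nu tr tl hl hr theta r).
Proof.
apply: iff_trans (iff_sym (maurer_cartan_alphaE _ _ _ _ _ _ _ _)).
split=> [[qt wd] s|al0].
  rewrite sum_lQ_alpha // sum_lb_alpha //.
  case: s => [|u [|v [|w [|z s]]]] //=; first by rewrite wd subrr.
  by rewrite qt subrr.
split=> [u v w|x y].
  have [/eqP] := al0 [:: u; v; w].
  by rewrite sum_lQ_alpha // subr_eq0 => /eqP.
have [_] := al0 [:: (0, x); (0, y)].
by rewrite sum_lb_alpha // => /(congr1 fst) /= /eqP; rewrite subr_eq0 => /eqP.
Qed.
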